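(* Let $G$ be a $P_9$-free chordal graph, let $C_1,\dots,C_\ell$ be its irredundant components, let $A\in\mathcal{D}_{RN}(G)$ and let $I\subseteq IR(G)$. Then $A\cup I$ is a minimal dominating set of $G$ (i.e. $I$ is an irredundant extension of $A$) if and only if, for every $i\in\{1,\dots,\ell\}$, the set $D_i=I\cap C_i$ is inclusion-minimal among the subsets $D\subseteq C_i$ such that (1) $D$ dominates $C_i\setminus N(A)$, and (2) $D$ does not dominate $Priv_{IR}(A,x)$ for any $x\in R_i(A)$.
   Context: All graphs are finite, simple and undirected. $N(x)$, $N[x]=N(x)\cup\{x\}$ are the open and closed neighbourhoods of $x$; for $X\subseteq V(G)$, $N[X]=\bigcup_{x\in X}N[x]$ and $N(X)=N[X]\setminus X$. A set $D$ dominates $X$ if $X\subseteq N[D]$; a minimal dominating set of $G$ is an inclusion-minimal set dominating $V(G)$. A vertex $x$ is irredundant if $N[x]$ is inclusion-minimal in $\{N[y]:y\in V(G)\}$, with the convention that among several vertices having the same inclusion-minimal closed neighbourhood exactly one (fixed) is declared irredundant; all other vertices are redundant. $IR(G)$, $RN(G)$ are the sets of irredundant and redundant vertices; an irredundant component is the vertex set of a connected component of $G[IR(G)]$. For $D\subseteq V(G)$ and $x\in D$, a private neighbour of $x$ w.r.t. $D$ is a vertex $u$ with $N[u]\cap D=\{x\}$ (possibly $u=x$); $Priv_{IR}(D,x)$ is the set of private neighbours of $x$ w.r.t. $D$ that lie in $IR(G)$. $\mathcal{D}_{RN}(G)=\{D\cap RN(G): D\text{ a minimal dominating set of }G\}$.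 For $A\subseteq RN(G)$: $B(A)$ is the set of $a\in A$ having an element of $Priv_{IR}(A,a)$ in some irredundant component $C$ with $C\subseteq N(A)$; $R(A)=A\setminus B(A)$; and $R_i(A)$ is the set of $x\in R(A)$ having at least one private neighbour w.r.t. $A$ in $C_i$. $P_k$-free means no induced path on $k$ vertices; chordal means no induced cycle of length at least four. *)

(* Defs.v *)
From mathcomp Require Import all_boot.

Set Implicit Arguments.
Unset Strict Implicit.
Unset Printing Implicit Defensive.

(* A graph is a finite vertex type T with an adjacency relation e, assumed    *)
(* symmetric and irreflexive in the theorem. *)

Definition induced (T : finType) (e : rel T) (k : nat) (r : rel 'I_k) : Prop :=
  exists f : 'I_k -> T,
    injective f /\ forall i j : 'I_k, e (f i) (f j) = r i j.

Definition path_rel (k : nat) : rel 'I_k :=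
  [rel i j : 'I_k | (i.+1 == j :> nat) || (j.+1 == i :> nat)].

(* ordS is the cyclic successor modulo k *)
Definition cycle_rel (k : nat) : rel 'I_k :=
  [rel i j : 'I_k | (ordS i == j) || (ordS j == i)].

Definition P_free (k : nat) (T : finType) (e : rel T) : Prop :=
  ~ induced e (@path_rel k).

Definition chordal (T : finType) (e : rel T) : Prop :=
  forall k : nat, 4 <= k -> ~ induced e (@cycle_rel k).

Definition cnbr (T : finType) (e : rel T) (x : T) : {set T} :=
  [set y | (y == x) || e x y].

Definition cnbrs (T : finType) (e : rel T) (X : {set T}) : {set T} :=
  \bigcup_(x in X) cnbr e x.

Definition nbrs (T : finType) (e : rel T) (X : {set T}) : {set T} :=
  cnbrs e X :\: X.

Definition dominates (T : finType) (e : rel T) (D X : {set T}) : bool :=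
  X \subset cnbrs e D.

Definition minimal_dominating (T : finType) (e : rel T) (D : {set T}) : bool :=
  minset (fun D' : {set T} => dominates e D' [set: T]) D.

Definition minimal_cnbr (T : finType) (e : rel T) (x : T) : bool :=
  minset (fun X : {set T} => X \in [set cnbr e y | y : T]) (cnbr e x).

(* Vertices sharing a minimal closed neighbourhood have exactly one declared  *)
(* irredundant representative. Which one is an arbitrary choice, so the set   *)
(* of irredundant vertices is a parameter IR subject to this predicate. *)
Definition irredundant_set (T : finType) (e : rel T) (IR : {set T}) : Prop :=
  (forall x : T, x \in IR -> minimal_cnbr e x) /\
  (forall x : T, minimal_cnbr e x ->
     exists! y : T, y \in IR /\ cnbr e y = cnbr e x).

Definition RN (T : finType) (IR : {set T}) : {set T} := ~: IR.

Definition irr_components (T : finType) (e : rel T) (IR : {set T}) :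
    {set {set T}} :=
  equivalence_partition
    (connect [rel x y | [&& x \in IR, y \in IR & e x y]]) IR.

Definition priv_IR (T : finType) (e : rel T) (IR D : {set T}) (x : T) :
    {set T} :=
  [set u in IR | cnbr e u :&: D == [set x]].

Definition D_RN (T : finType) (e : rel T) (IR : {set T}) : {set {set T}} :=
  [set D :&: RN IR | D : {set T} & minimal_dominating e D].

Definition B (T : finType) (e : rel T) (IR A : {set T}) : {set T} :=
  [set a in A | [exists C in irr_components e IR,
     (C \subset nbrs e A) && (priv_IR e IR A a :&: C != set0)]].

Definition R (T : finType) (e : rel T) (IR A : {set T}) : {set T} :=
  A :\: B e IR A.

(* R_i(A), indexed by the component C = C_i itself *)
Definition R_in (T : finType) (e : rel T) (IR A C : {set T}) : {set T} :=
  [set x in R e IR A | [exists u in C, cnbr e u :&: A == [set x]]].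

Definition admissible (T : finType) (e : rel T) (IR A C D : {set T}) : bool :=
  [&& D \subset C,
      dominates e D (C :\: nbrs e A) &
      [forall x in R_in e IR A C, ~~ dominates e D (priv_IR e IR A x)]].

(* Main.v *)
Require Import Defs.
From mathcomp Require Import all_boot zify.

(* A dominating set is minimal iff each of its members has a private neighbour,
   and since every closed neighbourhood contains an irredundant one, domination
   and private neighbours can be tested on IR alone.  This makes everything
   split along the irredundant components except the requirement that I leave
   some element of Priv_IR(A,x) undominated, which could a priori fail globally
   while holding in each component if Priv_IR(A,x), for x in R(A), met two of
   them.  Each such component contains a non-neighbour of x, hence yields an
   induced P5 starting at x; by chordality two of these P5 have no edge between
   them apart from x, so that together they form an induced P9. *)

Set Implicit Arguments.
Unset Strict Implicit.
Unset Printing Implicit Defensive.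

(** * Walks and induced paths in chordal graphs *)

Section Chordal.

Variables (T : finType) (e : rel T).
Hypotheses (e_sym : symmetric e) (e_irr : irreflexive e).

Definition induced_path (k : nat) (s : nat -> T) : Prop :=
  forall i j, i < k -> j < k -> e (s i) (s j) = (i.+1 == j) || (j.+1 == i).

(* In a path on at least four vertices, no two vertices have the same open
   neighbourhood. *)
Lemma induced_path_inj k s i j : 4 <= k -> induced_path k s ->
  i < k -> j < k -> s i = s j -> i = j.
Proof.
move=> k4 sP.
wlog lt_ij : i j / i < j.
  move=> W ik jk eq_s; case: (ltngtP i j) => // lt_ij; first exact: W.
  exact/esym/W.
move=> ik jk eq_s.
have rows m : m < k ->
    (i.+1 == m) || (m.+1 == i) = (j.+1 == m) || (m.+1 == j).
  by move=> mk; rewrite -!sP // eq_s.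
case: i => [|i] in lt_ij ik eq_s rows *; last by have := rows i; lia.
by have := rows 1; have := rows 3; lia.
Qed.

(** Induction on [n]: a chord or a repetition in the walk [f] gives a shorter walk with the same
    ends, and a walk with neither closes through [x] into an induced cycle of length n + 2, at least
    4. *)
Lemma chordal_no_detour x (f : nat -> T) n : chordal e ->
  e x (f 0) -> e x (f n) -> f 0 <> f n -> ~~ e (f 0) (f n) ->
  (forall i, i < n -> e (f i) (f i.+1)) ->
  (forall i, i <= n -> f i <> x) ->
  (forall i, i <= n -> e x (f i) -> f i = f 0 \/ f i = f n) -> False.
Proof.
move=> chG.
have [m] := ubnP n; elim: m => // m IH in n f * => lt_nm x0 xn f0n e0n fS fx xf.
have shortcut i d : i < n -> 0 < d -> i.+1 + d <= n ->
    e (f i) (f (i.+1 + d)) -> False.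
  move=> lt_in d0 le_n eid.
  pose g k := if k <= i then f k else f (k + d).
  have gn : g (n - d) = f n by rewrite /g ifF; [congr f; lia | lia].
  have gf k : k <= n - d -> exists2 k', k' <= n & g k = f k'.
    by rewrite /g; case: ifP => ? ?; [exists k | exists (k + d)] => //; lia.
  apply: (IH (n - d) g); rewrite ?gn //; first lia.
  - move=> k lt_k; rewrite /g; case: (ltngtP k i) => [lt_ki|lt_ik|->].
    + by apply: fS; lia.
    + by rewrite addSn; apply: fS; lia.
    + by [].
  - by move=> k /gf[k' le_k' ->]; apply: fx.
  - by move=> k /gf[k' le_k' ->]; apply: xf.
(* A repetition [f i = f j] is bypassed by the edge from [f i] to [f j.+1], or from [f i.-1] to
   [f j] when [j = n]. *)
have f_inj i j : i < j -> j <= n -> f i <> f j.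
  move=> lt_ij le_jn eq_f; have [eq_jn|ne_jn] := eqVneq j n.
    case: i => [|i] in lt_ij eq_f *; first by apply: f0n; rewrite eq_f eq_jn.
    apply: (shortcut i (j - i.+1)); [lia..|].
    by rewrite subnKC -?eq_f ?fS //; lia.
  apply: (shortcut i (j - i)); [lia..|].
  by rewrite addSn subnKC ?eq_f ?fS //; lia.
have n2 : 1 < n.
  case: n e0n f0n fS {IH lt_nm xn fx xf shortcut f_inj} => [//|[|//]] e01 _ fS.
  by rewrite fS in e01.
have ef i j : i < j -> j <= n -> e (f i) (f j) = (i.+1 == j).
  move=> lt_ij le_jn; case: eqP => [<-|ne_ij]; first by rewrite fS //; lia.
  apply/negP => eij; apply: (shortcut i (j - i.+1)); [lia..|].
  by rewrite subnKC.
have exf i : i <= n -> e x (f i) = (i == 0) || (i == n).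
  move=> le_in; case: eqP => [-> //|/eqP i0] /=; case: eqP => [-> //|ne_in].
  apply/negP => /(xf _ le_in) [/esym|]; apply: f_inj; lia.
apply: (chG n.+2); first lia.
exists (fun i : 'I_n.+2 => if i == n.+1 :> nat then x else f i); split.
  move=> i j; have := ltn_ord i; have := ltn_ord j.
  case: eqP => i_n; case: eqP => j_n jlt ilt eqf; apply: val_inj => /=.
  - by rewrite i_n j_n.
  - by case: (@fx j) => //; lia.
  - by case: (@fx i) => //; lia.
  - by case: (ltngtP i j) => // lt; [case: (f_inj _ _ lt) | case: (f_inj _ _ lt)];
      rewrite ?eqf //; lia.
have ordSE (i k : 'I_n.+2) :
    (ordS i == k) = if i == n.+1 :> nat then k == 0 :> nat else i.+1 == k :> nat.
  rewrite -val_eqE /=; have := ltn_ord i.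
  have [->|ne] := eqVneq (i : nat) n.+1 => lt; first by rewrite modnn eq_sym.
  by rewrite modn_small //; lia.
move=> i j; rewrite /cycle_rel /= !ordSE.
have := ltn_ord i; have := ltn_ord j.
case: eqP => i_n; case: eqP => j_n jlt ilt.
- by rewrite e_irr; lia.
- by rewrite exf; lia.
- by rewrite e_sym exf; lia.
- case: (ltngtP i j) => lt.
  + by rewrite ef; lia.
  + by rewrite e_sym ef; lia.
  + by rewrite lt e_irr; lia.
Qed.

(** An edge between the two tails would complete a detour around the common start [s 0], which is
    adjacent only to [s 1] and [t 1] on them. *)
Lemma chordal_P9 s t : chordal e -> s 0 = t 0 ->
  induced_path 5 s -> induced_path 5 t ->
  s 1 <> t 1 -> ~~ e (s 1) (t 1) -> induced e (@path_rel 9).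
Proof.
move=> chG st0 sP tP st1 est1.
have cross i j : 0 < i < 5 -> 0 < j < 5 -> e (s i) (t j) = false.
  move=> i5 j5; apply/negP => eij.
  (* The walk s 1, ..., s i, t j, ..., t 1. *)
  pose f k := if k < i then s k.+1 else t (j + i - k).
  have f0 : f 0 = s 1 by rewrite /f ifT //; lia.
  have fn : f (i + j).-1 = t 1 by rewrite /f ifF; [congr t; lia | lia].
  apply: (chordal_no_detour (x := s 0) (f := f) (n := (i + j).-1) chG);
    rewrite ?f0 ?fn //.
  - by rewrite sP.
  - by rewrite st0 tP.
  - move=> k lt_k; rewrite /f; case: (ltngtP k.+1 i) => [lt|lt|eq_k].
    + by rewrite sP; lia.
    + by rewrite tP; lia.
    + by rewrite eq_k addnK.
  - move=> k le_k; rewrite /f; case: ifP => lt eq_x.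
      by have := induced_path_inj (isT : 4 <= 5) sP _ _ eq_x; lia.
    by rewrite st0 in eq_x; have := induced_path_inj (isT : 4 <= 5) tP _ _ eq_x; lia.
  - move=> k le_k; rewrite /f; case: ifP => lt.
      by rewrite sP; [|lia..] => ?; left; congr s; lia.
    by rewrite st0 tP; [|lia..] => ?; right; congr t; lia.
pose f i := if i <= 4 then s (4 - i) else t (i - 4).
have fP : induced_path 9 f.
  move=> i j i9 j9; rewrite /f; case: ifP => i4; case: ifP => j4.
  - by rewrite sP; lia.
  - have [eq_i|ne_i] := eqVneq i 4; last by rewrite cross; lia.
    by rewrite eq_i subnn st0 tP; lia.
  - have [eq_j|ne_j] := eqVneq j 4; last by rewrite e_sym cross; lia.
    by rewrite eq_j subnn st0 tP; lia.
  - by rewrite tP; lia.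
(* That the two tails share no vertex follows from the adjacency pattern alone. *)
exists (fun i : 'I_9 => f i); split=> [i j eq_f|i j]; last by rewrite fP.
exact/val_inj/(induced_path_inj _ fP (ltn_ord i) (ltn_ord j) eq_f).
Qed.

(** * Domination and private neighbours *)

Lemma mem_cnbr x y : (y \in cnbr e x) = (y == x) || e x y.
Proof. by rewrite inE. Qed.

Lemma cnbr_sym x y : (y \in cnbr e x) = (x \in cnbr e y).
Proof. by rewrite !mem_cnbr eq_sym e_sym. Qed.

Lemma mem_cnbrs (D : {set T}) u : (u \in cnbrs e D) = (cnbr e u :&: D != set0).
Proof.
apply/bigcupP/set0Pn => [[x xD ux]|[x /setIP[xu xD]]]; exists x => //.
  by rewrite inE cnbr_sym ux.
by rewrite cnbr_sym.
Qed.

Lemma dominatesP (D X : {set T}) :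
  reflect (forall u, u \in X -> cnbr e u :&: D != set0) (dominates e D X).
Proof.
apply: (iffP subsetP) => domD u /domD; by rewrite mem_cnbrs.
Qed.

(** Removing [x] preserves a hereditary condition [N], so by minimality it breaks domination and
    leaves some [u] in [X] that [x] alone dominated. The generality in [X] and [N] covers both
    minimal dominating sets and minimal admissible sets. *)
Lemma minset_dominatesP (X : {set T}) (N : pred {set T}) (D : {set T}) :
  (forall D' : {set T}, D' \subset D -> N D -> N D') ->
  reflect [/\ dominates e D X, N D
            & forall x, x \in D -> exists2 u, u \in X & cnbr e u :&: D = [set x]]
          (minset (fun D' => dominates e D' X && N D') D).
Proof.
move=> Nmono; apply: (iffP minsetP) => [[/andP[domD ND] minD]|[domD ND privD]].
  split=> // x xD.
  have: ~~ dominates e (D :\ x) X.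
    apply/negP => domD'; have: D :\ x = D.
      by apply: minD; rewrite ?domD' ?subD1set // Nmono ?subD1set.
    by move/setP/(_ x); rewrite setD11 xD.
  case/subsetPn => u uX; rewrite mem_cnbrs negbK => /eqP ux0; exists u => //.
  have /set0Pn[y yuD] := dominatesP _ _ domD u uX.
  have sub z : z \in cnbr e u :&: D -> z = x.
    case/setIP=> zu zD; apply/eqP/negPn/negP => zx.
    by have := in_set0 z; rewrite -ux0 !inE zx zD andbT -mem_cnbr zu.
  apply/setP => z; rewrite in_set1; apply/idP/eqP => [/sub//|->].
  by rewrite -(sub _ yuD).
split=> [|D' /andP[domD' _] sD'D]; first by rewrite domD ND.
apply/eqP; rewrite eqEsubset sD'D; apply/subsetP => x xD.
have [u uX uD] := privD x xD.
have /set0Pn[y /setIP[yu yD']] := dominatesP _ _ domD' u uX.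
have: y \in cnbr e u :&: D by rewrite inE yu (subsetP sD'D).
by rewrite uD => /set1P <-.
Qed.

(** * Irredundant vertices *)

Section Irredundant.

Variable IR : {set T}.
Hypothesis IRP : irredundant_set e IR.

Lemma irredundant_below w : exists2 v, v \in IR & cnbr e v \subset cnbr e w.
Proof.
have wP : cnbr e w \in [set cnbr e y | y : T] by apply: imset_f.
have [X Xmin sXw] :=
  @minset_exists _ (fun X => X \in [set cnbr e y | y : T]) _ wP.
have /imsetP[y _ eqX] := minsetp Xmin.
have [|v [[vIR eqv] _]] := IRP.2 y; first by rewrite /minimal_cnbr -eqX.
by exists v; rewrite // eqv -eqX.
Qed.

(** Inclusion in a minimal neighbourhood is equality, and representatives are unique.
    Contrapositively, of two distinct irredundant vertices each has a neighbour outside the closed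
    neighbourhood of the other. *)
Lemma irredundant_inj v z :
  v \in IR -> z \in IR -> cnbr e v \subset cnbr e z -> v = z.
Proof.
move=> vIR zIR sub; have zmin := IRP.1 z zIR.
have [y [_ uniq_y]] := IRP.2 z zmin.
have eq_vz : cnbr e v = cnbr e z.
  by apply: (minsetinf zmin) => //; apply: imset_f.
by rewrite -(uniq_y v) // -(uniq_y z).
Qed.

Lemma dominates_IR D : dominates e D [set: T] = dominates e D IR.
Proof.
apply/dominatesP/dominatesP => domD u _; first exact: domD.
have [v vIR sub] := irredundant_below u.
have /set0Pn[y /setIP[yv yD]] := domD v vIR.
by apply/set0Pn; exists y; rewrite inE yD (subsetP sub).
Qed.

Lemma minimal_dominatingP D :
  reflect (dominates e D IR /\
           forall x, x \in D -> exists2 u, u \in IR & cnbr e u :&: D = [set x])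
          (minimal_dominating e D).
Proof.
have -> : minimal_dominating e D =
    minset (fun D' => dominates e D' IR && predT D') D.
  by apply: minset_eq => D'; rewrite andbT dominates_IR.
by apply: (iffP (minset_dominatesP _ _)) => // [[]|[]].
Qed.

(** * Irredundant components *)

Let adjIR := [rel x y | [&& x \in IR, y \in IR & e x y]].

Lemma adjIR_sym : connect_sym adjIR.
Proof. by apply: sym_connect_sym => x y /=; rewrite e_sym andbCA. Qed.

Lemma irr_component_sub C : C \in irr_components e IR -> C \subset IR.
Proof.
by case/imsetP=> a _ ->; apply/subsetP => x; rewrite inE => /andP[].
Qed.

Lemma irr_componentE C u v : C \in irr_components e IR -> u \in C ->
  (v \in C) = (v \in IR) && connect adjIR u v.
Proof.
case/imsetP=> a _ ->; rewrite !inE => /andP[_ cau].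
by rewrite (same_connect adjIR_sym cau).
Qed.

Lemma irr_component_adj C u v : C \in irr_components e IR -> u \in C ->
  v \in IR -> v \in cnbr e u -> v \in C.
Proof.
move=> CP uC vIR; rewrite mem_cnbr => /predU1P[-> //|euv].
have uIR := subsetP (irr_component_sub CP) u uC.
by rewrite (irr_componentE _ CP uC) vIR connect1 //= uIR vIR euv.
Qed.

Lemma irr_component_exists u : u \in IR ->
  exists2 C, C \in irr_components e IR & u \in C.
Proof.
move=> uIR; exists [set y in IR | connect adjIR u y]; first exact: imset_f.
by rewrite inE uIR connect0.
Qed.

Lemma irr_component_eq C1 C2 u : C1 \in irr_components e IR ->
  C2 \in irr_components e IR -> u \in C1 -> u \in C2 -> C1 = C2.
Proof.
move=> C1P C2P u1 u2; apply/setP => v.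
by rewrite (irr_componentE v C1P u1) (irr_componentE v C2P u2).
Qed.

(** * Induced paths from a redundant vertex into a component *)

Lemma irr_component_boundary C x u z : C \in irr_components e IR ->
  u \in C -> z \in C -> e x u -> ~~ e x z ->
  exists u' z', [/\ u' \in C, z' \in C, e u' z', e x u' & ~~ e x z'].
Proof.
move=> CP uC zC xu xz; have := zC.
rewrite (irr_componentE _ CP uC) => /andP[_ /connectP[p]].
elim: p u uC xu => [|a p IH] u uC xu /=.
  by move=> _ eqz; rewrite eqz xu in xz.
case/andP=> /and3P[uIR aIR ua] pP eqz.
have aC : a \in C by rewrite (irr_component_adj CP uC) // mem_cnbr ua orbT.
(* The edge sought is the first one of the path that leaves the neighbourhood of [x]. *)
have [xa|xa] := boolP (e x a); first exact: (IH a).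
by exists u, a.
Qed.

(* Every path x - u - z with u, z on the boundary extends by two vertices:
   a vertex w of N(z) \ N[u], and then either an irredundant v below w, or,
   when v is itself adjacent to z, the vertices v and p in N(v) \ N[z]. *)
Lemma irr_component_P5 C x u z : chordal e -> C \in irr_components e IR ->
  x \notin IR -> u \in C -> z \in C -> e x u -> ~~ e x z ->
  exists s, [/\ s 0 = x, s 1 \in C & induced_path 5 s].
Proof.
move=> chG CP xIR u0C z0C xu0 xz0.
have [{u0C xu0}u [{z0C xz0}z [uC zC uz xu xz]]] :=
  irr_component_boundary CP u0C z0C xu0 xz0.
have [uIR zIR] : u \in IR /\ z \in IR.
  by split; apply: (subsetP (irr_component_sub CP)).
have path_of a b : e z a -> e a b -> ~~ e u a -> ~~ e x a -> ~~ e z b ->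
    ~~ e u b -> ~~ e x b ->
    exists s, [/\ s 0 = x, s 1 \in C & induced_path 5 s].
  move=> za ab ua xa zb ub xb; exists (nth x [:: x; u; z; a; b]); split=> //.
  move=> i j.
  do 5?[case: i => [|i] //]; do 5?[case: j => [|j] //] => _ _ /=;
    rewrite ?e_irr ?xu ?uz ?za ?ab //;
    try (by rewrite e_sym ?xu ?uz ?za ?ab); apply/negbTE => //;
    by rewrite e_sym.
have xNz : x <> z by move=> xz'; rewrite xz' zIR in xIR.
have uNz : u <> z by move=> uz'; rewrite uz' e_irr in uz.
(* Otherwise x, u, z, a would be a 4-cycle lacking both chords. *)
have no4 a : e z a -> a <> u -> ~~ e u a -> ~~ e x a.
  move=> za aNu ua; apply/negP => xa.
  apply: (chordal_no_detour (x := x) (f := nth x [:: u; z; a]) (n := 2) chG) => //=.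
  - by move/esym.
  - by case=> [|[|i]].
  - case=> [|[|[|i]]] //= _ eqx; first by rewrite eqx e_irr in xu.
      by apply: xNz.
    by rewrite eqx e_irr in xa.
  - case=> [|[|[|i]]] //= _; [by left | by move=> xz'; rewrite xz' in xz | by right].
have /subsetPn[w zw uw] : ~~ (cnbr e z \subset cnbr e u).
  by apply/negP => /(irredundant_inj zIR uIR) /esym.
move: (uw); rewrite mem_cnbr negb_or => /andP[/eqP wNu euw].
have {}zw : e z w.
  by move: zw; rewrite mem_cnbr => /predU1P[wz|//]; rewrite wz uz in euw.
have xw := no4 w zw wNu euw.
have [v vIR /subsetP svw] := irredundant_below w.
(* As [cnbr e v] lies in [cnbr e w], [v] inherits from [w] the nonadjacency to [u] and [x]. *)
have uv : u \notin cnbr e v.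
  by apply/negP => /svw; rewrite cnbr_sym (negbTE uw).
have xv : x \notin cnbr e v.
  apply/negP => /svw; rewrite mem_cnbr e_sym (negbTE xw) orbF => /eqP xw'.
  by rewrite xw' e_sym zw in xz.
move: (uv) (xv); rewrite !mem_cnbr !negb_or ![e v _]e_sym.
move=> /andP[/eqP uNv euv] /andP[/eqP xNv exv].
have vNz : v <> z by move=> vz; rewrite vz uz in euv.
have [zv|zv] := boolP (e z v).
  have /subsetPn[p vp zp] : ~~ (cnbr e v \subset cnbr e z).
    by apply/negP => /(irredundant_inj vIR zIR).
  move: (zp); rewrite mem_cnbr negb_or => /andP[/eqP pNz ezp].
  have {}vp : e v p.
    by move: vp; rewrite mem_cnbr => /predU1P[pv|//]; rewrite pv zv in ezp.
  have pNu : p <> u by move=> pu; rewrite pu e_sym uz in ezp.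
  (* An edge between [u] and [p] would give a chordless 4-cycle u, z, v, p; without it, an edge
     between [x] and [p] would give a chordless 5-cycle x, u, z, v, p. *)
  have up : ~~ e u p.
    apply/negP => up.
    apply: (chordal_no_detour (x := u) (f := nth x [:: z; v; p]) (n := 2) chG) => //=.
    - by move/esym.
    - by case=> [|[|i]].
    - by case=> [|[|[|i]]] //= _ => /esym.
    - case=> [|[|[|i]]] //= _; [by left | by move=> uv'; rewrite uv' in euv | by right].
  have xp : ~~ e x p.
    apply/negP => xp.
    apply: (chordal_no_detour (x := x) (f := nth x [:: u; z; v; p]) (n := 3) chG) => //=.
    - by move/esym.
    - by case=> [|[|[|i]]].
    - case=> [|[|[|[|i]]]] //= _ eqx; first by rewrite eqx e_irr in xu.
      + exact: xNz.
      + exact: xNv.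
      + by rewrite eqx e_irr in xp.
    - case=> [|[|[|[|i]]]] //= _; [by left | | | by right].
        by move=> xz'; rewrite xz' in xz.
      by move=> xv'; rewrite xv' in exv.
  exact: (path_of v p).
have wv : e w v.
  have := svw v; rewrite !mem_cnbr eqxx => /(_ isT) /predU1P[vw|//].
  by rewrite vw zw in zv.
exact: (path_of w v).
Qed.

(** Vertices [s 1] and [t 1] of different components are distinct and nonadjacent, so the two
    five-vertex paths from [x] would merge into an induced path on nine vertices. *)
Lemma mixed_component_uniq C1 C2 x u1 z1 u2 z2 :
  P_free 9 e -> chordal e -> x \notin IR ->
  C1 \in irr_components e IR -> u1 \in C1 -> z1 \in C1 -> e x u1 -> ~~ e x z1 ->
  C2 \in irr_components e IR -> u2 \in C2 -> z2 \in C2 -> e x u2 -> ~~ e x z2 ->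
  C1 = C2.
Proof.
move=> P9G chG xIR C1P u1C z1C xu1 xz1 C2P u2C z2C xu2 xz2.
have [s [s0 s1 sP]] := irr_component_P5 chG C1P xIR u1C z1C xu1 xz1.
have [t [t0 t1 tP]] := irr_component_P5 chG C2P xIR u2C z2C xu2 xz2.
apply/eqP/negPn/negP => neC; apply: P9G.
suff st : t 1 \notin cnbr e (s 1).
  move: st; rewrite mem_cnbr negb_or => /andP[/eqP st1 est1].
  by apply: (chordal_P9 chG _ sP tP) => //; rewrite ?s0 ?t0 // => /esym.
apply: contra neC => st; apply/eqP/(irr_component_eq C1P C2P _ t1).
by apply: (irr_component_adj C1P s1) => //; apply: (subsetP (irr_component_sub C2P)).
Qed.

(** Containment in [C] and condition (2) pass to subsets, so minimality is felt only through
    domination of [C :\: nbrs e A]. *)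
Lemma admissible_minP (A C D : {set T}) :
  reflect [/\ D \subset C, dominates e D (C :\: nbrs e A),
     forall x, x \in R_in e IR A C -> ~~ dominates e D (priv_IR e IR A x)
   & forall x, x \in D ->
       exists2 u, u \in C :\: nbrs e A & cnbr e u :&: D = [set x]]
    (minset (admissible e IR A C) D).
Proof.
pose N (D' : {set T}) := (D' \subset C) &&
  [forall x in R_in e IR A C, ~~ dominates e D' (priv_IR e IR A x)].
have -> : minset (admissible e IR A C) D =
    minset (fun D' => dominates e D' (C :\: nbrs e A) && N D') D.
  by apply: minset_eq => D'; rewrite /admissible andbCA.
have Nmono (D' : {set T}) : D' \subset D -> N D -> N D'.
  move=> sub /andP[sDC /forall_inP ndom]; rewrite /N (subset_trans sub sDC).
  apply/forall_inP => x /ndom; apply: contra => /dominatesP domD'.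
  apply/dominatesP => u /domD' /set0Pn[y /setIP[yu yD']].
  by apply/set0Pn; exists y; rewrite inE yu (subsetP sub).
apply: (iffP (minset_dominatesP _ Nmono)).
  by case=> dom /andP[sub /forall_inP].
by case=> sub dom /forall_inP ndom priv; split=> //; rewrite /N sub.
Qed.

End Irredundant.

End Chordal.

(** * Splitting minimality of [A :|: I] along the components *)

Theorem theorem9 (T : finType) (e : rel T) (IR A I : {set T}) :
  symmetric e -> irreflexive e ->
  P_free 9 e -> chordal e ->
  irredundant_set e IR ->
  A \in D_RN e IR ->
  I \subset IR ->
  minimal_dominating e (A :|: I) <->
  (forall C : {set T}, C \in irr_components e IR ->
     minset (admissible e IR A C) (I :&: C)).
Proof.
move=> e_sym e_irr P9G chG IRP /imsetP[D Dmin AE] sI.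
have ANIR x : x \in A -> x \notin IR by rewrite AE !inE => /andP[].
(* A private neighbour with respect to [D] remains private for the subset [A]. *)
have AprivIR x : x \in A -> exists2 u, u \in IR & cnbr e u :&: A = [set x].
  move: Dmin; rewrite inE => /(minimal_dominatingP e_sym IRP)[_ Dpriv] xA.
  have [|u uIR uD] := Dpriv x; first by move: xA; rewrite AE inE => /andP[].
  exists u => //; rewrite AE setIA uD; apply/setIidPl.
  by rewrite sub1set inE ANIR.
have nbrsA u : u \in IR -> (u \in nbrs e A) = (cnbr e u :&: A != set0).
  move=> uIR; rewrite inE mem_cnbrs //.
  by rewrite (contraL (@ANIR u)).
have sCIR C := @irr_component_sub _ e IR C.
(* A vertex of [C] can be dominated by [I] only from inside [C], which makes domination by [I]
   local. *)
have cnbrI C u : C \in irr_components e IR -> u \in C ->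
    cnbr e u :&: (I :&: C) = cnbr e u :&: I.
  move=> CP uC; apply/setP => y; rewrite !(inE, in_setI).
  rewrite -!mem_cnbr; case yu: (y \in cnbr e u) => //=; case yI: (y \in I) => //=.
  by rewrite (irr_component_adj e_sym CP uC) // (subsetP sI).
split=> [/(minimal_dominatingP e_sym IRP)[dom priv] C CP|locmin].
  have CIR := subsetP (sCIR C CP).
  apply/(admissible_minP e_sym); split; first exact: subsetIr.
  - apply/(dominatesP e_sym) => u /setDP[uC]; rewrite nbrsA ?CIR // negbK => /eqP uA.
    by have := dominatesP e_sym _ _ dom u (CIR u uC); rewrite setIUr uA set0U cnbrI.
  (* A private neighbour of [x] with respect to [A :|: I] lies in [priv_IR e IR A x] and is
     undominated by [I]. *)
  - move=> x /setIdP[/setDP[xA _] _].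
    have [|u uIR uAI] := priv x; first by rewrite inE xA.
    apply/negP => /(dominatesP e_sym)/(_ u).
    have xNI : x \notin I by apply: contra (ANIR x xA); apply: (subsetP sI).
    have uA : cnbr e u :&: A = [set x].
      apply/setP => z; apply/idP/set1P => [/setIP[zu zA]|->].
        by apply/set1P; rewrite -uAI !inE -mem_cnbr zu zA.
      by have := set11 x; rewrite -{1}uAI !inE xA => /andP[-> _].
    rewrite inE uIR uA eqxx => /(_ isT)/set0Pn[y /setIP[yu /setIP[yI _]]].
    have: y \in [set x] by rewrite -uAI inE yu inE yI orbT.
    by move/set1P=> yx; rewrite -yx yI in xNI.
  - move=> x /setIP[xI xC].
    have [|u uIR uAI] := priv x; first by rewrite inE xI orbT.
    have xu : x \in cnbr e u.
      by have := set11 x; rewrite -{1}uAI => /setIP[].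
    have uC : u \in C by apply: (irr_component_adj e_sym CP xC); rewrite // cnbr_sym.
    have uA : cnbr e u :&: A = set0.
      apply/eqP/negPn/negP => /set0Pn[y /setIP[yu yA]].
      have: y \in [set x] by rewrite -uAI inE yu inE yA.
      by move/set1P=> yx; have := ANIR y yA; rewrite yx (subsetP sI).
    exists u; first by rewrite inE uC nbrsA // uA eqxx.
    by rewrite cnbrI // -uAI setIUr uA set0U.
have locP C (CP : C \in irr_components e IR) := admissible_minP e_sym IR A C _ (locmin C CP).
apply/(minimal_dominatingP e_sym IRP); split.
  apply/(dominatesP e_sym) => u uIR; have [C CP uC] := irr_component_exists e uIR.
  have [_ /(dominatesP e_sym) dom _ _] := locP C CP.
  rewrite setIUr setU_eq0 negb_and.
  case uA: (cnbr e u :&: A != set0) => //=.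
  by rewrite -(cnbrI C) // dom // inE uC nbrsA // uA.
move=> x /setUP[xA|xI]; last first.
  have [C CP xC] := irr_component_exists e (subsetP sI x xI).
  have [_ _ _ priv] := locP C CP.
  have [|u /setDP[uC]] := priv x; first by rewrite inE xI.
  have uIR := subsetP (sCIR C CP) u uC.
  rewrite nbrsA // negbK cnbrI // => /eqP uA uI.
  by exists u; rewrite // setIUr uA set0U.
suff [u uP uI] : exists2 u, u \in priv_IR e IR A x & cnbr e u :&: I = set0.
  by case/setIdP: uP => uIR /eqP uA; exists u; rewrite // setIUr uA uI setU0.
have [xB|xNB] := boolP (x \in B e IR A).
  case/setIdP: xB => _ /exists_inP[C CP /andP[CA /set0Pn[u /setIP[uP uC]]]].
  (* Since [C] lies in N(A), nothing in [C] remains to be dominated, and minimality forces [I :&: C]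
     to be empty. *)
  exists u => //; rewrite -(cnbrI C) //; have [_ _ _ priv] := locP C CP.
  apply/eqP/negPn/negP => /set0Pn[y /setIP[_ /priv[z]]].
  by case/setDP=> zC; rewrite (subsetP CA).
have [u uIR uA] := AprivIR x xA; have [C CP uC] := irr_component_exists e uIR.
(* As [x] is not in [B e IR A], a component meeting its private set is not contained in N(A), so it
   has a vertex nonadjacent to all of [A], in particular to [x]. *)
have mixed C' v : C' \in irr_components e IR -> v \in C' ->
    v \in priv_IR e IR A x ->
    e x v /\ exists2 z, z \in C' & ~~ e x z.
  move=> C'P vC' vP; have C'IR := subsetP (sCIR C' C'P); split.
    case/setIdP: (vP) => vIR /eqP vA; have := set11 x.
    rewrite -{1}vA inE mem_cnbr => /andP[/predU1P[xv|]]; last by rewrite e_sym.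
    by move=> /ANIR; rewrite xv vIR.
  have: ~~ (C' \subset nbrs e A).
    apply: contra xNB => C'A; rewrite inE xA; apply/exists_inP; exists C' => //.
    by rewrite C'A; apply/set0Pn; exists v; rewrite inE vP.
  case/subsetPn=> z zC'; rewrite nbrsA ?C'IR // negbK => /eqP zA; exists z => //.
  apply/negP => xz; have: x \in cnbr e z :&: A by rewrite in_setI mem_cnbr e_sym xz orbT.
  by rewrite zA inE.
have uP : u \in priv_IR e IR A x by rewrite inE uIR uA eqxx.
have [xu [z zC xz]] := mixed C u CP uC uP.
(* With the whole private set of [x] inside [C], condition (2) for [C] alone supplies an element
   undominated by all of [I]. *)
have privC v : v \in priv_IR e IR A x -> v \in C.
  move=> vP; have [vIR _] := setIdP vP.
  have [C' C'P vC'] := irr_component_exists e vIR.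
  have [xv [z' z'C' xz']] := mixed C' v C'P vC' vP.
  rewrite (_ : C = C') //.
  exact: (mixed_component_uniq e_sym e_irr IRP P9G chG (ANIR x xA) CP uC zC xu xz
    C'P vC' z'C').
have [_ _ ndom _] := locP C CP.
have /ndom/subsetPn[v vP] : x \in R_in e IR A C.
  rewrite inE in_setD xNB xA; apply/exists_inP; exists u => //.
  by rewrite uA.
rewrite mem_cnbrs // negbK cnbrI ?privC // => /eqP vI.
by exists v.
Qed.
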